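(* Let $n\in\mathbb{N}$, $n\ge 2$, and let $n=p_1^{m_1}p_2^{m_2}\cdots p_s^{m_s}$ be the decomposition of $n$ as a product of prime power factors ($p_1,\dots,p_s$ distinct primes, $m_1,\dots,m_s\ge 1$). Then the number $N$ of all distinct fuzzy subgroups with respect to $\approx$ of the finite cyclic group $\mathbb{Z}_n$ (that is, the number of equivalence classes of $FL(\mathbb{Z}_n)$ modulo $\approx$) is $$N=2^{\sum_{\alpha=1}^s m_\alpha}\ \sum_{i_2=0}^{m_2}\sum_{i_3=0}^{m_3}\cdots\sum_{i_s=0}^{m_s}\left(-\frac12\right)^{\sum_{\alpha=2}^s i_\alpha}\ \prod_{\alpha=2}^s\binom{m_\alpha}{i_\alpha}\binom{m_1+\sum_{\beta=2}^{\alpha}(m_\beta-i_\beta)}{m_\alpha},$$ where the iterated sums are equal to $1$ for $s=1$.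
   Context: Let $G$ be a finite group. A fuzzy subgroup of $G$ is a function $\mu:G\to[0,1]$ with $\mu(xy)\ge\min\{\mu(x),\mu(y)\}$ and $\mu(x^{-1})\ge\mu(x)$ for all $x,y\in G$; $FL(G)$ denotes the set of all fuzzy subgroups of $G$. For $\alpha\in[0,1]$ put ${}_\mu G_\alpha=\{x\in G\mid \mu(x)\ge\alpha\}$. If $\mu(G)=\{\alpha_1,\dots,\alpha_r\}$ with $\alpha_1>\alpha_2>\dots>\alpha_r$, then $\mu$ determines the chain of subgroups $\mathcal{C}_\mu:\ {}_\mu G_{\alpha_1}\subset{}_\mu G_{\alpha_2}\subset\dots\subset{}_\mu G_{\alpha_r}=G$ (strict inclusions). The relation $\approx$ on $FL(G)$: $\mu\approx\eta$ iff there exists $f\in\mathrm{Aut}(G)$ with $f(\mathcal{C}_\eta)=\mathcal{C}_\mu$, i.e. the two chains have the same number of terms and $f$ maps the $i$-th term of $\mathcal{C}_\eta$ onto the $i$-th term of $\mathcal{C}_\mu$ for every $i$. The number of distinct fuzzy subgroups of $G$ with respect to $\approx$ is the number of $\approx$-classes of $FL(G)$; equivalently, it is the number of orbits of $\mathrm{Aut}(G)$ acting termwise on the set of strictly increasing chains $H_1\subset H_2\subset\dots\subset H_m=G$ ($m\ge1$) of subgroups of $G$ ending in $G$ (the first term $H_1$ need not be trivial). *)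

(* Defs.v *)
From mathcomp Require Import all_boot all_order all_algebra all_fingroup.
From mathcomp Require Import classical_sets cardinality reals.

Set Implicit Arguments.
Unset Strict Implicit.
Unset Printing Implicit Defensive.

Import Order.TTheory GRing.Theory Num.Theory GroupScope.
Local Open Scope ring_scope.

Section FuzzySubgroups.
Variables (R : realType) (gT : finGroupType).
Implicit Types mu eta : gT -> R.

Definition fuzzy_subgroup mu : Prop :=
  [/\ forall x, 0 <= mu x <= 1,
      forall x y, Num.min (mu x) (mu y) <= mu (x * y)%g
    & forall x, mu x <= mu x^-1%g].

Definition level_set mu (alpha : R) : {set gT} := [set x | alpha <= mu x]%SET.

Definition fuzzy_values mu : seq R := sort >=%R (undup (codom mu)).

Definition level_chain mu : seq {set gT} :=
  [seq level_set mu alpha | alpha <- fuzzy_values mu].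

(* Equality of sequences: both chains have the same number of terms and f maps
   the i-th term of the chain of eta onto the i-th term of the chain of mu. *)
Definition fuzzy_equiv mu eta : Prop :=
  exists2 f : {perm gT}, f \in Aut [set: gT]%SET &
    [seq f @: H | H : {set gT} <- level_chain eta] = level_chain mu.

Definition FL : set (gT -> R) := [set mu | fuzzy_subgroup mu]%classic.

Definition fuzzy_class mu : set (gT -> R) :=
  [set eta | FL eta /\ fuzzy_equiv mu eta]%classic.

Definition fuzzy_classes : set (set (gT -> R)) :=
  [set fuzzy_class mu | mu in FL]%classic.

End FuzzySubgroups.

Arguments FL R gT : clear implicits.
Arguments fuzzy_classes R gT : clear implicits.

(* Main.v *)
Require Import Defs.
From mathcomp Require Import all_boot all_order all_algebra all_fingroup.
From mathcomp Require Import cyclic.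
From mathcomp Require Import classical_sets cardinality reals.
From mathcomp Require Import ring.

Set Implicit Arguments.
Unset Strict Implicit.
Unset Printing Implicit Defensive.

Import Order.TTheory GRing.Theory Num.Theory.
Local Open Scope ring_scope.

(* Automorphisms of a cyclic group fix every subgroup, so the classes are
   counted by the strict chains of subgroups ending in G.  If c_j counts those
   with j proper terms, the weak multichains of length k number
     sum_j 'C(k, j) c_j = prod_a 'C(m_a + k, k),
   the right-hand side by induction on k because a subgroup of G is given by its
   exponents.  Expanding products by
     'C(M + k, k) 'C(m + k, k) =
       sum_i (-1)^i 'C(m, i) 'C(M + m - i, m) 'C(M + m - i + k, k)
   one prime after the other, and 'C(M + k, k) = sum_j 'C(k, j) 'C(M, j), yields
   c_j by inversion of the binomial transform; summing over j turns each
   'C(M, j) into 2 ^ M. *)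

(** * Binomial identities *)

(** The left side is the [m]-th forward difference at [N] of ['C(x, r + m)] in [x]; by Pascal's rule
    each difference lowers the bottom index by one. *)
Lemma alternating_bin_sum (R : pzRingType) (N r m : nat) :
  \sum_(i < m.+1) (-1) ^+ i * ('C(m, i) * 'C(N + m - i, r + m))%N%:R
  = 'C(N, r)%:R :> R.
Proof.
elim: m N r => [|m IH] N r.
  by rewrite big_ord1 expr0 mul1r bin0 mul1n addn0 subn0 addn0.
rewrite -[RHS]IH.
transitivity (\sum_(i < m.+1) (-1) ^+ i *
    ('C(m, i) * 'C((N + m - i).+1, r + m.+1))%N%:R -
  \sum_(i < m.+1) (-1) ^+ i * ('C(m, i) * 'C(N + m - i, r + m.+1))%N%:R : R).
  rewrite big_ord_recl /= expr0 mul1r bin0 mul1n.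
  under eq_bigr => i _.
    rewrite binS mulnDl natrD mulrDr /bump /= add1n addnS subSS; over.
  rewrite big_split /= addrA; congr (_ + _).
    rewrite [RHS]big_ord_recl /= expr0 mul1r bin0 mul1n addnS !subn0.
    congr (_ + _); rewrite big_ord_recr /= bin_small // mul0n mulr0 addr0.
    apply: eq_bigr => i _; rewrite /bump /= add1n subnS prednK //.
    by rewrite subn_gt0 (leq_trans (ltn_ord i)) // leq_addl.
  rewrite -sumrN; apply: eq_bigr => i _.
  by rewrite exprS mulN1r mulNr.
rewrite -sumrB; apply: eq_bigr => i _.
by rewrite addnS binS mulnDr natrD mulrDr addrAC subrr add0r.
Qed.

(** For [m <= A] both sides are the trinomial coefficient of [A + k] with parts [A - m], [m] and
    [k]; otherwise both vanish. *)
Lemma mul_bin_addl (A m k : nat) :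
  ('C(A, m) * 'C(A + k, k) = 'C(m + k, k) * 'C(A + k, m + k))%N.
Proof.
have [Am|mA] := ltnP A m.
  by rewrite (bin_small Am) (@bin_small (A + k) (m + k)) ?ltn_add2r ?muln0.
rewrite -(subnK mA); move: (A - m)%N => t.
have f u v : ('C(u + v, v) * (u`! * v`!) = (u + v)`!)%N.
  by rewrite -(bin_fact (leq_addl u v)) addnK [(u`! * _)%N]mulnC.
apply/eqP; rewrite -(eqn_pmul2r (_ : 0 < t`! * m`! * k`!)%N) ?muln_gt0 ?fact_gt0 //.
apply/eqP; transitivity (t + m + k)`!%N; first by rewrite -!f; ring.
by rewrite -addnA -(f t (m + k)%N) -(f m k); ring.
Qed.

(** Expanding ['C(M + k, k)] with bottom index [k + m] lets each term absorb ['C(m + k, k)] and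
    leaves a single binomial in [k]. *)
Lemma bin_mul_expand (R : pzRingType) (k M m : nat) :
  ('C(M + k, k) * 'C(m + k, k))%N%:R =
  \sum_(i < m.+1) (-1) ^+ i *
    ('C(m, i) * 'C(M + (m - i), m) * 'C(M + (m - i) + k, k))%N%:R :> R.
Proof.
rewrite natrM -(alternating_bin_sum _ (M + k) k m) mulr_suml.
apply: eq_bigr => i _; rewrite -mulrA -natrM; congr (_ * _%:R).
rewrite -!mulnA; congr (_ * _)%N.
have im: (i <= m)%N by rewrite -ltnS.
by rewrite mul_bin_addl mulnC [(k + m)%N]addnC -addnBA // addnAC.
Qed.

Lemma bin_add_expand (k M : nat) :
  ('C(M + k, k) = \sum_(j < k.+1) 'C(k, j) * 'C(M, j))%N.
Proof.
rewrite addnC -binomial.Vandermonde (reindex_inj rev_ord_inj).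
apply: eq_bigr => j _; have jk: (j <= k)%N by rewrite -ltnS.
by rewrite /= subSS bin_sub // subKn.
Qed.

(** The system is triangular with diagonal entries ['C(k, k) = 1]. *)
Lemma bin_transform_inj (R : pzRingType) (c d : nat -> R) :
  (forall k, \sum_(j < k.+1) 'C(k, j)%:R * c j =
             \sum_(j < k.+1) 'C(k, j)%:R * d j) ->
  c =1 d.
Proof.
move=> cd; elim/ltn_ind => k IH.
have := cd k; rewrite !big_ord_recr /= binn !mul1r.
by under eq_bigr => i _ do rewrite IH //; move/addrI.
Qed.

(** The free bound [B] lets one range of summation serve many [M] at once. *)
Lemma sum_bin_lt (B M : nat) : (M < B)%N -> (\sum_(j < B) 'C(M, j) = 2 ^ M)%N.
Proof.
move=> MB; rewrite -[2%N]/(1 + 1)%N expnDn.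
rewrite (big_ord_widen B (fun i => 'C(M, i) * (1 ^ (M - i) * 1 ^ i))%N) //.
rewrite [RHS]big_mkcond; apply: eq_bigr => j _; rewrite !exp1n !muln1 ltnS.
by case: leqP => // /bin_small.
Qed.

(** * Expansion over dependent families of exponents *)

(** The type of a value varies with its index, hence the transport along the equation supplied by
    [unliftP]. *)
Definition dffun_cons s (T : 'I_s.+1 -> finType) (j : T ord0)
    (i : {dffun forall a : 'I_s, T (lift ord0 a)}) : {dffun forall a, T a} :=
  [ffun a => match unliftP ord0 a with
             | UnliftSome k e => eq_rect_r T (i k) e
             | UnliftNone e => eq_rect_r T j e
             end].

Lemma dffun_cons0 s (T : 'I_s.+1 -> finType) j i : @dffun_cons s T j i ord0 = j.
Proof.
by rewrite ffunE; case: unliftP => [k //|e]; rewrite (eq_axiomK e).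
Qed.

Lemma dffun_cons_lift s (T : 'I_s.+1 -> finType) j i a :
  @dffun_cons s T j i (lift ord0 a) = i a.
Proof.
rewrite ffunE; case: unliftP => [k e|//].
(* Identifying [k] with [a] turns [e] into a loop, which [eq_axiomK] removes. *)
have ak := lift_inj e; case: k / ak e => e.
by rewrite (eq_axiomK e).
Qed.

Lemma big_dffun_recl (R : Type) (idx : R) (op : Monoid.com_law idx) s
    (T : 'I_s.+1 -> finType) (F : {dffun forall a, T a} -> R) :
  \big[op/idx]_(i : {dffun forall a, T a}) F i =
  \big[op/idx]_(j : T ord0)
    \big[op/idx]_(i : {dffun forall a : 'I_s, T (lift ord0 a)})
      F (dffun_cons j i).
Proof.
rewrite pair_bigA /= (reindex (fun u => dffun_cons u.1 u.2)) //=.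
exists (fun f : {dffun forall a, T a} =>
  (f ord0, [ffun a => f (lift ord0 a)] : {dffun forall a, T (lift ord0 a)})).
  case=> j i _ /=; rewrite dffun_cons0; congr (_, _).
  by apply/ffunP => a; rewrite ffunE dffun_cons_lift.
move=> f _; apply/ffunP => a /=.
case: (unliftP ord0 a) => [k|] ->; last by rewrite dffun_cons0.
by rewrite dffun_cons_lift ffunE.
Qed.

(** When prime [a] is absorbed, [M] has already grown by [m b - i b] for each [b < a]; its own
    [m a - i a] enters in the same step, hence [b <= a]. *)
Definition bin_coef (R : pzRingType) (M s : nat) (m i : 'I_s -> nat) : R :=
  (-1) ^+ (\sum_a i a)%N * \prod_a
    ('C(m a, i a) * 'C(M + \sum_(b : 'I_s | (b <= a)%N) (m b - i b), m a))%N%:R.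

(** Induction on [s] for all [M]: absorbing the first prime replaces [M] by [M + (m ord0 - j)] for
    the remaining ones. *)
Lemma prod_bin_expand (R : comPzRingType) (k M s : nat) (m : 'I_s -> nat) :
  ('C(M + k, k) * \prod_a 'C(m a + k, k))%N%:R =
  \sum_(i : {dffun forall a, 'I_(m a).+1})
    bin_coef R M m (fun a => i a) *
    'C(M + \sum_(a < s) (m a - i a) + k, k)%N%:R :> R.
Proof.
elim: s => [|s IH] in M m *.
  pose i0 : {dffun forall a : 'I_0, 'I_(m a).+1} := [ffun a => ord0].
  have eq_i0 i : i = i0 by apply/ffunP => -[].
  rewrite (big_pred1 i0) => [|i]; last by rewrite [i]eq_i0 /= eqxx.
  by rewrite /bin_coef !big_ord0 expr0 !mul1r muln1 addn0.
rewrite big_ord_recl mulnA natrM bin_mul_expand mulr_suml.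
rewrite (big_dffun_recl _ (T := fun a => 'I_(m a).+1)).
apply: eq_bigr => j _; rewrite -mulrA -natrM -mulnA natrM IH !mulr_sumr.
apply: eq_bigr => i _.
have c0 := dffun_cons0 (T := fun a => 'I_(m a).+1) j i.
have cS := dffun_cons_lift (T := fun a => 'I_(m a).+1) j i.
move: (dffun_cons _ _) c0 cS => /= c c0 cS.
rewrite /bin_coef !big_ord_recl c0.
have sum0 : (\sum_(b : 'I_s.+1 | (b <= @ord0 s)%N) (m b - c b) = m ord0 - j)%N.
  by rewrite big_mkcond big_ord_recl /= c0 big1 ?addn0.
rewrite sum0.
(* In each partial sum the term at [ord0] joins [M], as in the induction hypothesis. *)
under [X in _ = _ * (_ * X) * _]eq_bigr => a _.
  rewrite big_mkcond big_ord_recl /= c0 cS addnA.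
  under eq_bigr => b _ do rewrite cS /bump /= !add1n ltnS.
  rewrite -big_mkcond /=; over.
under [X in _ = _ * _ * ('C(_ + (_ + X) + _, _)%:R)]eq_bigr => a _ do rewrite cS.
under [X in _ = (-1) ^+ (_ + X) * _ * _]eq_bigr => a _ do rewrite cS.
rewrite !addnA exprD.
by rewrite !natrM; ring.
Qed.

(** * Strict chains and weak multichains *)

Fixpoint rpaths (T : finType) (r : rel T) (j : nat) (x : T) : seq (seq T) :=
  if j is j'.+1 then [seq y :: c | y <- enum (r x), c <- rpaths r j' y]
  else [:: [::]].

Lemma mem_rpaths (T : finType) (r : rel T) j x c :
  (c \in rpaths r j x) = (size c == j) && path r x c.
Proof.
elim: j x c => [|j IH] x [|y c] //=.
  by apply/negP => /allpairsPdep[? [? []]].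
rewrite eqSS andbCA -IH; apply/allpairsPdep/andP.
  by case=> z [d [+ + [-> ->]]]; rewrite mem_enum.
by case=> xy yc; exists y, c; rewrite mem_enum.
Qed.

Lemma rpaths_uniq (T : finType) (r : rel T) j x : uniq (rpaths r j x).
Proof.
elim: j x => [|j IH] x //=; apply: allpairs_uniq_dep => //.
  exact: enum_uniq.
by move=> [? ?] [? ?] _ _ [-> ->].
Qed.

Lemma size_rpathsS (T : finType) (r : rel T) j x :
  size (rpaths r j.+1 x) = (\sum_(y | r x y) size (rpaths r j y))%N.
Proof.
by rewrite /= size_allpairs_dep sumnE big_map big_enum.
Qed.

(* A weak multichain of length [k] is a strict chain of length [j <= k] together
   with the choice of the [j] positions at which it moves. *)
Lemma sum_bin_rpaths (T : finType) (r : rel T) (w : nat -> T -> nat) :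
  (forall x, w 0 x = 1)%N ->
  (forall k x, w k.+1 x = w k x + \sum_(y | r x y) w k y)%N ->
  forall k x, (\sum_(j < k.+1) 'C(k, j) * size (rpaths r j x) = w k x)%N.
Proof.
move=> w0 wS; elim=> [|k IH] x; first by rewrite big_ord1 w0.
rewrite wS big_ord_recl.
(* By Pascal's rule, the ['C(k, j.+1)] together with the term of index 0 give [w k x], while the
   ['C(k, j)] go with chains whose first step [y] is peeled off. *)
under [X in (_ + X)%N = _]eq_bigr => j _ do rewrite lift0 binS mulnDl.
rewrite big_split addnA /=; congr (_ + _)%N.
  rewrite -IH // [RHS]big_ord_recl big_ord_recr /= (@bin_small k k.+1) // addn0.
  by rewrite !bin0.
under [LHS]eq_bigr => j _ do rewrite size_rpathsS big_distrr /=.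
rewrite exchange_big /=; apply: eq_bigr => y xy.
by rewrite IH.
Qed.

(** * Divisors as families of exponents *)

Lemma prod_sum_dffun (s : nat) (m : 'I_s -> nat) (F : 'I_s -> nat -> nat) :
  (\prod_a \sum_(e < (m a).+1) F a e =
   \sum_(i : {dffun forall a, 'I_(m a).+1}) \prod_a F a (i a))%N.
Proof.
elim: s => [|s IH] in m F *.
  pose i0 : {dffun forall a : 'I_0, 'I_(m a).+1} := [ffun a => ord0].
  have eq_i0 i : i = i0 by apply/ffunP => -[].
  rewrite big_ord0 (big_pred1 i0) => [|i]; last by rewrite [i]eq_i0 /= eqxx.
  by rewrite big_ord0.
rewrite big_ord_recl (IH (fun a => m (lift ord0 a)) (fun a => F (lift ord0 a))).
rewrite (big_dffun_recl _ (T := fun a => 'I_(m a).+1)) /=.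
rewrite big_distrl; apply: eq_bigr => j _; rewrite big_distrr.
apply: eq_bigr => i _; rewrite [RHS]big_ord_recl.
rewrite (dffun_cons0 (T := fun a => 'I_(m a).+1)); congr (_ * _)%N.
by apply: eq_bigr => a _; rewrite (dffun_cons_lift (T := fun a => 'I_(m a).+1)).
Qed.

Section PrimePowers.
Variables (s : nat) (p : 'I_s -> nat).
Hypotheses (p_prime : forall a, prime (p a)) (p_inj : injective p).

Lemma prod_primeX_gt0 (e : 'I_s -> nat) : (0 < \prod_a p a ^ e a)%N.
Proof. by rewrite prodn_gt0 // => a; rewrite expn_gt0 prime_gt0. Qed.

(** With [q] arbitrary this also covers numbers outside the list, where the sum is empty. *)
Lemma logn_prod_primeX q (e : 'I_s -> nat) :
  logn q (\prod_a p a ^ e a)%N = (\sum_(a | p a == q) e a)%N.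
Proof.
rewrite (@big_morph_in _ _ [pred x | 0 < x]%N (logn q) 0 addn 1 muln) /=.
- rewrite [RHS]big_mkcond; apply: eq_bigr => a _.
  by rewrite lognX logn_prime // eq_sym; case: eqP; rewrite ?muln1 ?muln0.
- by move=> x y; rewrite !inE muln_gt0 => -> ->.
- by [].
- by move=> x y; rewrite !inE; apply: lognM.
- exact: logn1.
- by move=> a _; rewrite inE expn_gt0 prime_gt0.
Qed.

Lemma logn_prod_primeX_eq b (e : 'I_s -> nat) :
  logn (p b) (\prod_a p a ^ e a)%N = e b.
Proof.
by rewrite logn_prod_primeX (eq_bigl (pred1 b)) ?big_pred1_eq // => a; apply: inj_eq.
Qed.

Lemma perm_divisors_prod_primeX (m : 'I_s -> nat) :
  perm_eq (divisors (\prod_a p a ^ m a))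
    [seq (\prod_a p a ^ i a)%N | i : {dffun forall a, 'I_(m a).+1}].
Proof.
apply: uniq_perm; first exact: divisors_uniq.
  rewrite map_inj_uniq ?enum_uniq // => i j eq_ij.
  apply/ffunP => a; apply: val_inj.
  by rewrite /= -(logn_prod_primeX_eq a (fun a => i a)) eq_ij logn_prod_primeX_eq.
move=> d; rewrite -dvdn_divisors ?prod_primeX_gt0 //; apply/idP/mapP.
  move=> dN; have d0 : (0 < d)%N := dvdn_gt0 (prod_primeX_gt0 m) dN.
  have ledN q : (logn q d <= logn q (\prod_a p a ^ m a))%N.
    exact: dvdn_leq_log (prod_primeX_gt0 m) dN.
  have em a : (logn (p a) d < (m a).+1)%N.
    by rewrite ltnS -[leqRHS](logn_prod_primeX_eq a m).
  exists [ffun a => Ordinal (em a)]; first by rewrite mem_enum.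
  apply: eqn_from_log => // [|q]; first exact: prod_primeX_gt0.
  (* A [q] outside the list has exponent 0 in the full product, hence in [d]. *)
  have [/existsP[a /eqP <-]|] := boolP [exists a, p a == q].
    by rewrite logn_prod_primeX_eq ffunE.
  rewrite negb_exists => /forallP pq; apply/eqP; rewrite eqn_leq.
  move: (ledN q); rewrite !logn_prod_primeX !big1 ?leqn0 => [/eqP-> //|a|a];
    by rewrite (negPf (pq a)).
case=> i _ ->; apply: (big_ind2 (fun x y => x %| y)%N) => //.
  by move=> *; apply: dvdn_mul.
by move=> a _; apply: dvdn_exp2l; rewrite -ltnS.
Qed.

Lemma sum_divisors_prod (m : 'I_s -> nat) (F : 'I_s -> nat -> nat) :
  (\sum_(d <- divisors (\prod_a p a ^ m a)) \prod_a F a (logn (p a) d) =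
   \prod_a \sum_(e < (m a).+1) F a e)%N.
Proof.
rewrite (perm_big _ (perm_divisors_prod_primeX m)) big_map big_enum /=.
rewrite prod_sum_dffun; apply: eq_bigr => i _; apply: eq_bigr => a _.
by rewrite logn_prod_primeX_eq.
Qed.

(** Hockey-stick identity: for one prime, the passage from multichains of length [k] to length
    [k.+1]. *)
Lemma sum_bin_diag (k m : nat) :
  (\sum_(e < m.+1) 'C(e + k, k) = 'C(m + k.+1, k.+1))%N.
Proof.
elim: m => [|m IH]; first by rewrite big_ord1 !binn.
by rewrite big_ord_recr IH /= [in RHS]addSn binS addSnnS.
Qed.

End PrimePowers.

(** * Multichains of subgroups of a cyclic group *)

(** A cyclic group has exactly one subgroup of each order dividing its own. *)
Lemma sum_cyclic_subgroups (gT : finGroupType) (H : {group gT}) (F : nat -> nat) :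
  cyclic H ->
  (\sum_(K : {group gT} | K \subset H) F #|K| = \sum_(d <- divisors #|H|) F d)%N.
Proof.
move=> cycH; rewrite -big_enum -(big_map (fun K : {group gT} => #|K|) xpredT F).
apply: perm_big; apply: uniq_perm; last 1 first.
- move=> d; rewrite -dvdn_divisors ?cardG_gt0 //; apply/mapP/idP.
    by case=> K; rewrite mem_enum => KH ->; apply: cardSg.
  have /cyclicP[x defH] := cycH; rewrite [in #|H|]defH => /cycle_sub_group.
  move/setP/(_ <[x ^+ (#[x]%g %/ d)]>%G); rewrite inE set11 -defH.
  by case/andP=> KH /eqP Kd; exists (<[x ^+ (#[x]%g %/ d)]>%G)%g; rewrite ?mem_enum.
- rewrite map_inj_in_uniq ?enum_uniq // => K L; rewrite !mem_enum => KH LH eqKL.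
  by apply/val_inj/eqP; rewrite /= (eq_subG_cyclic cycH) ?eqKL.
- exact: divisors_uniq.
Qed.

Section ChainCount.
Variables (gT : finGroupType) (s : nat) (p m : 'I_s -> nat).
Hypotheses (p_prime : forall a, prime (p a)) (p_inj : injective p).
Hypotheses (cycG : cyclic [set: gT]).
Hypothesis cardG : #|[set: gT]| = (\prod_a p a ^ m a)%N.

(** Closed form for the number of weakly descending sequences of [k] subgroups of [H]: each prime
    contributes a weakly decreasing sequence of exponents. *)
Definition multichains k (H : {group gT}) : nat :=
  (\prod_a 'C(logn (p a) #|H| + k, k))%N.

Definition psubgroup : rel {group gT} := fun H K => K \proper H.

Lemma card_subgroup_primeX (H : {group gT}) :
  #|H| = (\prod_a p a ^ logn (p a) #|H|)%N.
Proof.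
have : #|H| \in divisors #|[set: gT]|.
  by rewrite -dvdn_divisors ?cardG_gt0 //; apply: cardSg (finset.subsetT H).
rewrite cardG (perm_mem (perm_divisors_prod_primeX p_prime p_inj m)).
case/mapP=> i _ ->; apply: eq_bigr => a _.
by rewrite logn_prod_primeX_eq.
Qed.

(** The first term [K] ranges over all subgroups of [H]; the sum over divisors factors into
    hockey-stick sums, and splitting off [K = H] leaves the strict steps. *)
Lemma multichainsS k (H : {group gT}) :
  multichains k.+1 H =
  (multichains k H + \sum_(K | psubgroup H K) multichains k K)%N.
Proof.
transitivity (\sum_(K : {group gT} | K \subset H) multichains k K)%N.
  rewrite (@sum_cyclic_subgroups _ _ (fun d => \prod_a 'C(logn (p a) d + k, k))%N).
    rewrite card_subgroup_primeX.
    rewrite (sum_divisors_prod p_prime p_inj _ (fun a e => 'C(e + k, k))).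
    by apply: eq_bigr => a _; rewrite sum_bin_diag.
  exact: cyclicS (finset.subsetT H) cycG.
rewrite (bigD1 H) //=; congr (_ + _)%N; apply: eq_bigl => K.
by rewrite /psubgroup finset.properEneq andbC -val_eqE.
Qed.

Lemma sum_bin_subgroup_chains k :
  (\sum_(j < k.+1) 'C(k, j) * size (rpaths psubgroup j [set: gT]) =
   \prod_a 'C(m a + k, k))%N.
Proof.
rewrite (@sum_bin_rpaths _ _ multichains) => [|H|k' H].
- rewrite /multichains cardG; apply: eq_bigr => a _.
  by rewrite logn_prod_primeX_eq.
- by rewrite /multichains big1 // => a _; rewrite bin0.
- exact: multichainsS.
Qed.

End ChainCount.

(** * Fuzzy subgroups and their chains *)

Section FuzzyChains.
Variables (R : realType) (gT : finGroupType).
Implicit Types (mu eta : gT -> R) (c : seq {set gT}).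

(* Starting the path at the empty set costs nothing, as groups are nonempty. *)
Definition subgroup_chain c : bool :=
  [&& path (fun H K : {set gT} => H \proper K) finset.set0 c, all group_set c
    & last finset.set0 c == [set: gT]].

Lemma fuzzy_values_ltd mu : sorted >%R (fuzzy_values mu).
Proof.
have ge_sorted : sorted >=%R (fuzzy_values mu).
  by apply: sort_sorted => x y; rewrite orbC; apply: le_total.
have : sorted <%R (rev (fuzzy_values mu)).
  by rewrite lt_sorted_uniq_le rev_uniq sort_uniq undup_uniq rev_sorted.
by rewrite rev_sorted.
Qed.

Lemma fuzzy_valuesP mu alpha :
  reflect (exists x, alpha = mu x) (alpha \in fuzzy_values mu).
Proof. by rewrite mem_sort mem_undup; apply: codomP. Qed.

Lemma group_set_level mu alpha :
  FL R gT mu -> alpha \in fuzzy_values mu -> group_set (level_set mu alpha).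
Proof.
case=> _ muM muV /fuzzy_valuesP[x ->].
apply/group_setP; split=> [|y z]; rewrite !inE.
  have := muM x x^-1%g; rewrite mulgV; apply: le_trans.
  by rewrite le_min lexx muV.
by move=> xy xz; apply: le_trans (muM y z); rewrite le_min xy.
Qed.

Lemma subgroup_chain_level mu : FL R gT mu -> subgroup_chain (level_chain mu).
Proof.
move=> FLmu; have grp : all group_set (level_chain mu).
  by apply/allP=> _ /mapP[alpha alphaP ->]; apply: group_set_level.
apply/and3P; split => //.
  have : sorted (fun H K : {set gT} => H \proper K) (level_chain mu).
    rewrite sorted_map; apply: (sub_in_sorted (P := mem (fuzzy_values mu)));
      [|exact/allP|exact: fuzzy_values_ltd].
    (* Strictness: a point where the smaller value is attained lies in the later level only. *)
    move=> alpha beta _ /fuzzy_valuesP[x ->] lt_beta.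
    apply/properP; split; last by exists x; rewrite !inE ?lexx // -ltNge.
    by apply/fintype.subsetP => y; rewrite !inE; apply/le_trans/ltW.
  case: (level_chain mu) grp => //= H c /andP[/group_setP[H1 _] _] ->.
  by rewrite andbT proper0; apply/finset.set0Pn; exists 1%g.
rewrite finset.eqEsubset finset.subsetT; apply/fintype.subsetP => x _.
have : mu x \in fuzzy_values mu by apply/fuzzy_valuesP; exists x.
have := fuzzy_values_ltd mu.
(* The last value is the least one, so its level is the whole group. *)
rewrite /level_chain; case/lastP: (fuzzy_values mu) => [//|v b].
rewrite map_rcons last_rcons inE -rev_sorted rev_rcons /= => /order_path_min.
move/(_ _)/allP => min_b; rewrite mem_rcons inE => /predU1P[-> //|xv].
by apply/ltW/min_b; [apply: lt_trans | rewrite mem_rev].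
Qed.

(** The witness sends [x] to the inverse of one plus the position of the first term containing [x],
    so values fall along the chain and levels recover its terms. *)
Lemma level_chain_subgroup_chain c :
  subgroup_chain c -> exists2 mu, FL R gT mu & level_chain mu = c.
Proof.
case/and3P => chain_c grp_c /eqP last_c.
pose idx x := find (fun H : {set gT} => x \in H) c.
have c_neq0 : (0 < size c)%N.
  by case: c last_c {chain_c grp_c idx} => //= /setP/(_ 1%g); rewrite !inE.
have idx_lt x : (idx x < size c)%N.
  rewrite -has_find; apply/hasP; exists (last finset.set0 c); last by rewrite last_c inE.
  by case: c c_neq0 {chain_c grp_c last_c idx} => //= *; apply: mem_last.
(* Prefixing the empty set makes entry [i] the predecessor of term [i], even for [i = 0]. *)
have proper_nth i : (i < size c)%N ->
    nth finset.set0 (finset.set0 :: c) i \proper nth finset.set0 c i.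
  exact: (pathP finset.set0 chain_c).
have sub_nth i j : (i <= j)%N -> (j < size c)%N ->
    nth finset.set0 c i \subset nth finset.set0 c j.
  move=> /subnKC <-; elim: (j - i)%N => [|d IH]; first by rewrite addn0.
  rewrite addnS => ltc; apply: fintype.subset_trans (IH (ltnW ltc)) _.
  exact: proper_sub (proper_nth _ ltc).
have mem_nth_idx x i : (i < size c)%N -> (x \in nth finset.set0 c i) = (idx x <= i)%N.
  move=> ic; apply/idP/idP => [xi|le_i].
    by rewrite leqNgt; apply/negP => /(before_find finset.set0); rewrite xi.
  apply: (fintype.subsetP (sub_nth _ _ le_i ic)).
  apply: (@nth_find _ finset.set0 (fun H : {set gT} => x \in H)).
  by rewrite has_find; apply: idx_lt.
(* Strict inclusions ensure that every position is attained, so no term is lost among the levels. *)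
have idx_onto i : (i < size c)%N -> exists x, idx x = i.
  move=> ic; have [_ [x xi xNi]] := properP (proper_nth i ic).
  exists x; apply/eqP; rewrite eqn_leq -mem_nth_idx // xi /=.
  case: i ic xNi {xi} => // i ic; rewrite /= mem_nth_idx ?(ltnW ic) //.
  by rewrite -ltnNge.
pose mu x : R := (idx x).+1%:R^-1.
have mu_le x y : (mu x <= mu y) = (idx y <= idx x)%N.
  by rewrite lef_pV2 ?posrE ?ltr0n // ler_nat ltnS.
have grp_nth i : (i < size c)%N -> group_set (nth finset.set0 c i).
  by move=> ic; apply: (allP grp_c); apply: mem_nth.
exists mu.
  split=> [x|x y|x].
  - by rewrite invr_ge0 ler0n invf_le1 ?ltr0n // ler1n.
  - rewrite ge_min !mu_le -!mem_nth_idx //.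
    have [le_xy|/ltnW le_yx] := leqP (idx x) (idx y); apply/orP; [right|left].
      have /group_setP[_ grpM] := grp_nth _ (idx_lt y).
      by apply: grpM; rewrite mem_nth_idx.
    have /group_setP[_ grpM] := grp_nth _ (idx_lt x).
    by apply: grpM; rewrite mem_nth_idx.
  - rewrite mu_le -mem_nth_idx //.
    by rewrite -(groupV (Group (grp_nth _ (idx_lt x)))) /= invgK mem_nth_idx.
have values_mu : fuzzy_values mu = [seq i.+1%:R^-1 | i <- iota 0 (size c)].
  apply: (@irr_sorted_eq _ >%R) => [y x z|x||| alpha].
  - by move=> xy yz; apply: lt_trans yz xy.
  - exact: ltxx.
  - exact: fuzzy_values_ltd.
  - rewrite sorted_map; apply: sub_sorted (iota_ltn_sorted 0 (size c)) => i j ij /=.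
    by rewrite ltf_pV2 ?posrE ?ltr0n // ltr_nat.
  apply/fuzzy_valuesP/mapP => [[x ->]|[i + ->]].
    by exists (idx x); rewrite // mem_iota; apply: idx_lt.
  by rewrite mem_iota => /idx_onto[x <-]; exists x.
rewrite /level_chain values_mu -map_comp -[RHS](mkseq_nth finset.set0).
apply/eq_in_map => i; rewrite mem_iota => ic; apply/setP => x /=.
by rewrite inE mem_nth_idx // lef_pV2 ?posrE ?ltr0n // ler_nat ltnS.
Qed.

(** Every subgroup of a cyclic group is characteristic, so an automorphism fixes each term of the
    chain. *)
Lemma fuzzy_equiv_cyclic mu eta :
  cyclic [set: gT] -> FL R gT eta ->
  fuzzy_equiv mu eta <-> level_chain eta = level_chain mu.
Proof.
move=> cycG /subgroup_chain_level/and3P[_ /allP grp_eta _].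
have fix_chain f : f \in Aut [set: gT]%SET ->
    [seq f @: H | H : {set gT} <- level_chain eta] = level_chain eta.
  move=> Af; apply: map_id_in => H /grp_eta grpH.
  have /andP[_ /forall_inP/(_ f Af) fH] : (Group grpH \char [set: gT])%g.
    by rewrite sub_cyclic_char // finset.subsetT.
  by apply/eqP; rewrite eqEcard fH card_imset ?leqnn //; apply: perm_inj.
split=> [[f Af <-]|eq_chain]; first by rewrite fix_chain.
by exists 1%g; rewrite ?group1 // fix_chain ?group1.
Qed.

(** The classes are the fibres of [level_chain], and these are nonempty, so distinct chains give
    distinct classes. *)
Lemma card_fuzzy_classes_cyclic :
  cyclic [set: gT] ->
  (fuzzy_classes R gT #= [set c | subgroup_chain c]%classic)%card.
Proof.
move=> cycG.
pose cls c : set (gT -> R) := [set eta | FL R gT eta /\ level_chain eta = c]%classic.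
have -> : fuzzy_classes R gT = [set cls c | c in [set c | subgroup_chain c]]%classic.
  have cls_level mu : fuzzy_class mu = cls (level_chain mu).
    apply/seteqP; split=> eta [FLeta] eq_eta; split=> //.
      exact/fuzzy_equiv_cyclic.
    exact/fuzzy_equiv_cyclic.
  apply/seteqP; split=> [_ [mu FLmu <-]|_ [c chain_c <-]].
    by exists (level_chain mu); [apply: subgroup_chain_level | rewrite cls_level].
  have [mu FLmu eq_c] := level_chain_subgroup_chain chain_c.
  by exists mu; rewrite // cls_level eq_c.
apply: inj_card_eq => c d /set_mem chain_c _ eq_cd.
have [mu FLmu eq_c] := level_chain_subgroup_chain chain_c.
have [_ <-] : cls d mu by rewrite -[cls d]eq_cd.
by rewrite eq_c.
Qed.

(** * Counting chains as descending paths of groups *)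

Lemma subgroup_chain_rev (c : seq {group gT}) :
  subgroup_chain (rev [seq (H : {set gT}) | H : {group gT} <- [set: gT]%G :: c]) =
  path (@psubgroup gT) [set: gT]%G c.
Proof.
rewrite /subgroup_chain all_rev all_map /= rev_cons last_rcons eqxx andbT.
rewrite (introT allP) ?andbT; last by move=> H _; apply: groupP.
rewrite -[path _ finset.set0 _]/(sorted _ (_ :: _)) -[X in sorted _ X]revK rev_sorted.
rewrite rev_cons rev_rcons revK /= rcons_path.
rewrite -[[set: gT]%SET]/(gval [set: gT]%G) path_map last_map andbC.
have -> : finset.set0 \proper gval (last [set: gT]%G c).
  by rewrite proper0; apply/finset.set0Pn; exists 1%g; apply: group1.
by rewrite groupP andbT.
Qed.

Lemma subgroup_chain_revP d :
  reflect (exists2 c : seq {group gT}, path (@psubgroup gT) [set: gT]%G c &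
             rev [seq (H : {set gT}) | H : {group gT} <- [set: gT]%G :: c] = d)
          (subgroup_chain d).
Proof.
apply: (iffP idP) => [chain_d|[c pc <-]]; last by rewrite subgroup_chain_rev.
suff [c eq_c] : exists c : seq {group gT},
    rev [seq (H : {set gT}) | H : {group gT} <- [set: gT]%G :: c] = d.
  by exists c; rewrite // -subgroup_chain_rev eq_c.
case/and3P: chain_d => _.
case/lastP: d => [_ /eqP/setP/(_ 1%g)|d G]; first by rewrite !inE.
rewrite all_rcons last_rcons => /andP[_ /all_filterP grp_d] /eqP->.
(* [insub] restores the group structure and drops nothing, all terms being groups. *)
exists (rev (pmap insub d)); rewrite /= rev_cons -map_rev revK.
by rewrite (pmap_filter (insubK _)) (eq_filter (isSome_insub _)) grp_d.
Qed.

Lemma card_set_uniq (T : eqType) (s : seq T) :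
  uniq s -> ([set` s]%classic #= `I_(size s))%card.
Proof.
case: s => [_|x0 s]; first by rewrite II0 set_nil.
set l := x0 :: s => uniq_l.
have -> : [set` l]%classic = [set nth x0 l i | i in `I_(size l)]%classic.
  apply/seteqP; split=> x /=; first by case/(nthP x0) => i; exists i.
  by case=> i il <-; apply: mem_nth.
apply: inj_card_eq => i j /set_mem il /set_mem jl /eqP.
by rewrite nth_uniq // => /eqP.
Qed.

(** Members of a strict chain are distinct, so the number [j] of proper terms is below
    [#|{group gT}|] and lengths [j < B] exhaust all chains. *)
Lemma card_subgroup_chains B :
  (#|{group gT}| <= B)%N ->
  ([set c | subgroup_chain c]%classic #=
     `I_(\sum_(j < B) size (rpaths (@psubgroup gT) j [set: gT])))%card.
Proof.
move=> gB; pose L := [seq h | j <- iota 0 B, h <- rpaths (@psubgroup gT) j [set: gT]%G].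
pose f (c : seq {group gT}) : seq {set gT} :=
  rev [seq (H : {set gT}) | H : {group gT} <- [set: gT]%G :: c].
have uniqL : uniq L.
  apply: allpairs_uniq_dep; [exact: iota_uniq | by move=> *; apply: rpaths_uniq |].
  move=> _ _ /allpairsPdep[i [c [_ ic ->]]] /allpairsPdep[j [d [_ jd ->]]] /= eq_cd.
  move: ic jd; rewrite eq_cd !mem_rpaths => /andP[/eqP <- _] /andP[/eqP <- _] //.
have memL (c : seq {group gT}) : (c \in L) = path (@psubgroup gT) [set: gT]%G c.
  apply/allpairsPdep/idP => [[j [d [_ + ->]]]|pc].
    by rewrite mem_rpaths => /andP[].
  exists (size c), c; rewrite mem_rpaths eqxx pc mem_iota; split=> //=.
  have uniq_c : uniq ([set: gT]%G :: c).
    apply: (sorted_uniq (leT := @psubgroup gT)) => [K H M KH MK | H | //].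
      exact: proper_trans MK KH.
    by rewrite /psubgroup fintype.properxx.
  by apply: leq_trans gB; rewrite -[(size c).+1](card_uniqP uniq_c) max_card.
have -> : (\sum_(j < B) size (rpaths (@psubgroup gT) j [set: gT]) = size L)%N.
  by rewrite size_allpairs_dep sumnE big_map -[B]subn0 -/(index_iota 0 _) big_mkord subn0.
have -> : [set c | subgroup_chain c]%classic = [set f h | h in [set` L]]%classic.
  apply/seteqP; split=> d /=.
    by case/subgroup_chain_revP => c pc <-; exists c; rewrite //= memL.
  by case=> c; rewrite /= memL => pc <-; apply/subgroup_chain_revP; exists c.
apply: card_eq_trans (card_set_uniq uniqL).
apply: inj_card_eq => c d _ _ /(can_inj revK)[]; apply: inj_map; apply: val_inj.
Qed.

End FuzzyChains.

(* The primes are p 0, ..., p s (s + 1 of them), so the informal p_1, m_1 are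
   p ord0, m ord0, and the informal index a = 2, 3, ... is [lift ord0 a] with
   a : 'I_s.  The iterated sum over 0 <= i_a <= m_a is one sum over dependent
   finite functions; it is the one-term sum with value 1 when s = 0.  The group
   law of the finGroupType 'Z_n is addition modulo n (n > 1). *)
Theorem theorem4p1p2 (R : realType) (n s : nat) (p m : 'I_s.+1 -> nat)
    (n_ge2 : (2 <= n)%N)
    (p_prime : forall a, prime (p a)) (p_inj : injective p)
    (m_gt0 : forall a, (0 < m a)%N)
    (n_fact : n = (\prod_(a < s.+1) p a ^ m a)%N) :
  exists2 N : nat,
    (fuzzy_classes R 'Z_n #= `I_N)%card &
    N%:R = 2 ^+ (\sum_(a < s.+1) m a)%N *
      \sum_(i : {dffun forall a : 'I_s, 'I_(m (lift ord0 a)).+1})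
        (- (1 / 2)) ^+ (\sum_(a < s) i a)%N *
        \prod_(a < s)
          ('C(m (lift ord0 a), i a)%N%:R *
           'C(m ord0 + \sum_(b < s | (b <= a)%N) (m (lift ord0 b) - i b),
              m (lift ord0 a))%N%:R) :> rat.
Proof.
have cycG : cyclic [set: 'Z_n] by apply/cyclicP; exists (Zp1 : 'Z_n); apply: Zp_cycle.
have cardG : #|[set: 'Z_n]%SET| = (\prod_a p a ^ m a)%N.
  by rewrite cardsT card_ord Zp_cast.
(* [B] has to bound the lengths of all chains and to exceed every [deg i]. *)
pose B := (#|{group 'Z_n}| + (\sum_a m a).+1)%N.
exists (\sum_(j < B) size (rpaths (@psubgroup 'Z_n) j [set: 'Z_n]))%N.
  apply: card_eq_trans (card_fuzzy_classes_cyclic R cycG) _.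
  by apply: card_subgroup_chains; apply: leq_addr.
pose m' a := m (lift ord0 a).
pose coef (i : {dffun forall a, 'I_(m' a).+1}) : rat :=
  bin_coef rat (m ord0) m' (fun a => i a).
pose deg (i : {dffun forall a, 'I_(m' a).+1}) :=
  (m ord0 + \sum_a (m' a - i a))%N.
pose c j : rat := (size (rpaths (@psubgroup 'Z_n) j [set: 'Z_n]))%:R.
pose d j : rat := \sum_i coef i * 'C(deg i, j)%:R.
have eq_cd : c =1 d.
  apply: bin_transform_inj => k.
  under eq_bigr => j _ do rewrite -natrM.
  rewrite -natr_sum (sum_bin_subgroup_chains p_prime p_inj cycG cardG).
  rewrite big_ord_recl prod_bin_expand.
  under [RHS]eq_bigr => j _ do rewrite mulr_sumr.
  rewrite exchange_big; apply: eq_bigr => i _ /=.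
  rewrite bin_add_expand natr_sum mulr_sumr; apply: eq_bigr => j _.
  by rewrite natrM mulrCA.
(* This turns [2 ^ deg i] into [2 ^ (\sum_a m a)] divided by [2 ^ (\sum_a i a)], whence the powers
   of [-1/2]. *)
have degE (i : {dffun forall a, 'I_(m' a).+1}) : (deg i + \sum_a i a = \sum_a m a)%N.
  rewrite /deg -addnA -big_split big_ord_recl; congr (_ + _)%N.
  by apply: eq_bigr => a _; rewrite /= subnK // -ltnS.
rewrite natr_sum (eq_bigr (fun j : 'I_B => d j)) => [|j _]; last exact: eq_cd.
rewrite exchange_big mulr_sumr; apply: eq_bigr => i _.
have degB : (deg i < B)%N.
  by rewrite /B addnS ltnS -(degE i) addnCA leq_addr.
rewrite -mulr_sumr -natr_sum sum_bin_lt // natrX /coef /bin_coef.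
rewrite -(degE i) exprD.
have -> : (- (1 / 2)) ^+ (\sum_a i a)%N =
   (-1) ^+ (\sum_a i a)%N * 2^-1 ^+ (\sum_a i a)%N :> rat.
  by rewrite -exprMn mulN1r div1r.
under [X in _ = _ * (_ * X)]eq_bigr => a _ do rewrite -natrM.
rewrite exprVn; field.
by rewrite expf_neq0.
Qed.
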